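(* Let $\mathsf f$ be a complexity function. For any pair $(w_c,p_c)$ in the $\mathsf f$-Teaching Book such that $@\prec p_c$, there is an interposed library for the concept $c$, i.e. a library $B$ with $TS_\ell^{\mathsf f}(c|B)>TS_\ell^{\mathsf f}(c)$.
   Context: Languages and programs. $L$ is a universal (Turing-complete) language whose programs are finite sequences of instructions from a finite alphabet $\Upsilon$, each instruction coded with the same number $\log_2|\Upsilon|$ of bits. Let $\Sigma=\{0,1\}^*$. For a program $p$, $\dot\ell(p)$ is its length in number of instructions and $\ell(p)$ its length in bits. $\prec$ is the total order on programs given first by length and then, for equal length, by lexicographic order over $\Upsilon$. A program $p$ computes a map $\Sigma\to\Sigma\cup\{\perp\}$, where $p(\mathtt i)=\perp$ means that $p$ does not halt on $\mathtt i$. An $L$-concept is a function $c:\Sigma\to\Sigma\cup\{\perp\}$ computed by at least one program of $L$; $C_L$ is the set of $L$-concepts and $[c]_L$ the set of programs of $L$ computing $c$. Libraries. A library is a finite set $B=\{p_1,\dots,p_k\}$ of programs (primitives). $\Upsilon$ always includes an instruction $@$ for static library calls, and $@$ is the last instruction in the lexicographic order. $@\mathsf i$ denotes the instruction calling the primitive of index $\mathsf i$; if $|B|=1$ no index is needed and the call is written $@$. A call has length $\ell(@\mathsf i)=\log_2|\Upsilon|+\log_2|B|$ bits. $L_B$ is the language $L$ with static calls to $B$; $[c]_{L_B}$ is the set of programs of $L_B$ computing $c$. Examples. $X=\Sigma\times(\Sigma\cup\{\perp\})$. An example set is a finite subset $S=\{\langle \mathtt i_j,\mathtt o_j\rangle\}_{j=1}^k$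 of $X$ without different outputs for equal inputs. $\delta(S)$ is the number of bits of the encoding of $S$ by a fixed prefix (self-delimiting) code. $\lessdot$ is a fixed total order on example sets such that $S\lessdot S'$ implies $\delta(S)\le\delta(S')$. Time-bounded compatibility. $\lambda_L(\mathtt i,S)$ is a time bound (in steps, for input $\mathtt i$), of the form $\rho\cdot\min\{\ell(\mathtt i),\ell(\mathtt i_{max})\}+\ell(\mathtt o_{max})$ with $\rho$ a constant and $\mathtt i_{max},\mathtt o_{max}$ the longest input and output in $S$, that suffices for a program employing a trie (lookup table) for $S$. A complexity function is a function $\mathsf f:\mathbb N\to\mathbb N$ acting as a time bound. $p\vDash_{\mathsf f}S$ means that for each $\langle \mathtt i,\mathtt o\rangle\in S$, within $\max\{\mathsf f(\ell(\mathtt i)),\lambda_L(\mathtt i,S)\}$ time steps, $p$ on input $\mathtt i$ outputs $\mathtt o$ if $\mathtt o\ne\perp$, and does not halt if $\mathtt o=\perp$. Learner, teacher, teaching size. $\Phi_\ell^{\mathsf f}(S)$ (resp. $\Phi_\ell^{\mathsf f}(S|B)$) is the $\prec$-first program $p$ of $L$ (resp. of $L_B$) with $p\vDash_{\mathsf f}S$. $\Omega_\ell^{\mathsf f}(c)$ (resp. $\Omega_\ell^{\mathsf f}(c|B)$) is the $\lessdot$-first example set $S$ with $\Phi_\ell^{\mathsf f}(S)\in[c]_L$ (resp. $\Phi_\ell^{\mathsf f}(S|B)\in[c]_{L_B}$). $TS_\ell^{\mathsf f}(c)=\delta(\Omega_\ell^{\mathsf f}(c))$ and $TS_\ell^{\mathsf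 f}(c|B)=\delta(\Omega_\ell^{\mathsf f}(c|B))$. Teaching Book. The $\mathsf f$-Teaching Book consists of the pairs $(w_c,p_c)$ with $w_c=\Omega_\ell^{\mathsf f}(c)$ and $p_c=\Phi_\ell^{\mathsf f}(w_c)\in[c]_L$, for those concepts $c$ for which such a witness set exists, listed in the order of $w_c$; no program and no witness set is repeated.
   Formalization: Added hypothesis (the claim fails without it): every example set S with δ(S)=δ(w_c) whose learned program computes c has that program after @ in ≺, not only S=w_c. Program length in ≺ is the number of instructions, each library call counting as one. *)

(* Defs.v *)
From mathcomp Require Import all_boot all_order.
From mathcomp Require Import finmap.
From mathcomp.classical Require Import boolp.

Set Implicit Arguments.
Unset Strict Implicit.
Unset Printing Implicit Defensive.

Definition word := seq bool.

(* [None] is the undefined value, i.e. non-termination. *)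
Definition concept := word -> option word.

(* Kleene's schemes over binary words (recursion on notation and unary
   minimization) rather than over natural numbers, so that no coding of words
   by numbers is involved.  Missing arguments are read as the empty word. *)
Inductive rcode : Type :=
  | RNil
  | RCons of bool
  | RProj of nat
  | RComp of rcode & seq rcode
  | RRec of rcode & rcode & rcode
  | RMu of rcode.

Inductive reval : rcode -> seq word -> word -> Prop :=
  | ev_nil xs : reval RNil xs [::]
  | ev_cons b xs : reval (RCons b) xs (b :: nth [::] xs 0)
  | ev_proj k xs : reval (RProj k) xs (nth [::] xs k)
  | ev_comp g hs xs ys z :
      size ys = size hs ->
      (forall k, k < size hs -> reval (nth RNil hs k) xs (nth [::] ys k)) ->
      reval g ys z ->
      reval (RComp g hs) xs z
  | ev_rec0 g h0 h1 xs z :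
      reval g xs z -> reval (RRec g h0 h1) ([::] :: xs) z
  | ev_recS g h0 h1 b x xs y z :
      reval (RRec g h0 h1) (x :: xs) y ->
      reval (if b then h1 else h0) [:: y, x & xs] z ->
      reval (RRec g h0 h1) ((b :: x) :: xs) z
  | ev_mu g xs n :
      reval g (nseq n true :: xs) [::] ->
      (forall m, m < n ->
         exists b y, reval g (nseq m true :: xs) (b :: y)) ->
      reval (RMu g) xs (nseq n true).

(* A finite subset of Sigma x (Sigma + bot) without different outputs for
   equal inputs is a finite partial map. *)
Definition exset := {fmap word -> option word}.

Definition out_len (o : option word) : nat := oapp size 0 o.

Definition imax_len (S : exset) : nat := \max_(i : domf S) size (val i).
Definition omax_len (S : exset) : nat := \max_(i : domf S) out_len (S i).

Definition trie_bound (rho : nat) (i : word) (S : exset) : nat :=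
  rho * minn (size i) (imax_len S) + omax_len S.

Record example_coding := ExampleCoding {
  encode : exset -> seq bool;
  encode_prefix_free :
    forall S T, prefix (encode S) (encode T) -> S = T;
  elt : rel exset;
  elt_irr : irreflexive elt;
  elt_trans : transitive elt;
  elt_total : forall S T, S != T -> elt S T || elt T S;
  elt_size : forall S T, elt S T -> size (encode S) <= size (encode T)
}.

Definition delta (E : example_coding) (S : exset) : nat := size (encode E S).

(* [O] is the ordered alphabet without the call instruction @.
   [exec p i = Some (t, o)]: on input [i] the program [p] halts after [t] time
   steps with output [o]; [exec p i = None]: it does not halt. *)
Record language (d : Order.disp_t) (O : finOrderType d) := Language {
  exec : seq O -> word -> option (nat * word);
  rho : nat;
  turing_complete :
    forall g : rcode, exists p : seq O, forall x y,
      (exists t, exec p x = Some (t, y)) <-> reval g [:: x] y;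
  trie_program :
    forall S : exset, exists p : seq O, forall i o, S.[? i]%fmap = Some o ->
      if o is Some y then
        exists2 t, exec p i = Some (t, y) & t <= trie_bound rho i S
      else exec p i = None
}.

(* Instructions of a language with library: those of [O], and the calls @j. *)
Notation instr O := (O + nat)%type.
Notation program O := (seq (O + nat)%type).

Definition call (T : Type) (j : nat) : T + nat := inr j.

Section Programs.
Context (d : Order.disp_t) (O : finOrderType d).

Definition instr_lt (a b : instr O) : bool :=
  match a, b with
  | inl x, inl y => (x < y)%O
  | inl _, inr _ => true
  | inr _, inl _ => false
  | inr i, inr j => i < j
  end.

Fixpoint lex_lt (p q : program O) : bool :=
  match p, q with
  | a :: p', b :: q' => instr_lt a b || (a == b) && lex_lt p' q'
  | _, _ => false
  end.

(* Length is the number of instructions; a call @j is one instruction. *)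
Definition prec (p q : program O) : bool :=
  (size p < size q) || (size p == size q) && lex_lt p q.

(* The primitives are programs of the base language; their position in the
   list is their index. *)
Definition is_library (B : seq (seq O)) : bool := uniq B.

(* The programs of L_B.  There is nothing to call in the empty library, so the
   programs of L itself are those of L_B for B = [::]. *)
Definition is_program (B : seq (seq O)) (p : program O) : bool :=
  all (fun a => if a is inr j then j < size B else true) p.

(* Static calls: each call is replaced by the code of the primitive. *)
Definition expand (B : seq (seq O)) (p : program O) : seq O :=
  flatten [seq match a with inl x => [:: x] | inr j => nth [::] B j end
          | a <- p].

End Programs.

Definition first_for (T : Type) (lt : rel T) (P : T -> Prop) (x : T) : Prop :=
  P x /\ forall y, P y -> y = x \/ lt x y.

Definition the_first (T : Type) (lt : rel T) (P : T -> Prop) : option T :=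
  if pselect (exists x, first_for lt P x) is left h
  then Some (projT1 (cid h)) else None.

(* Order on teaching sizes, where [None] is the infinite size of a concept
   without witness set. *)
Definition size_gt (m n : option nat) : Prop :=
  match m, n with
  | Some m', Some n' => n' < m'
  | None, Some _ => True
  | _, None => False
  end.

Section Teaching.
Context (d : Order.disp_t) (O : finOrderType d).
Context (L : language O) (E : example_coding) (f : nat -> nat).

Definition run (B : seq (seq O)) (p : program O) (i : word) :
  option (nat * word) := exec L (expand B p) i.

(* Membership of [p] in the class of programs of L_B computing [c]. *)
Definition computes (B : seq (seq O)) (p : program O) (c : concept) : Prop :=
  is_program B p /\ forall i, omap snd (run B p i) = c i.

Definition is_concept (c : concept) : Prop := exists p, computes [::] p c.

Definition time_bound (i : word) (S : exset) : nat :=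
  maxn (f (size i)) (trie_bound (rho L) i S).

Definition compatible (B : seq (seq O)) (p : program O) (S : exset) : Prop :=
  forall i o, S.[? i]%fmap = Some o ->
    if o is Some y then
      exists2 t, run B p i = Some (t, y) & t <= time_bound i S
    else
      forall t y, run B p i = Some (t, y) -> time_bound i S < t.

Definition learner (B : seq (seq O)) (S : exset) : option (program O) :=
  the_first (@prec d O) (fun p => is_program B p /\ compatible B p S).

Definition identifies (B : seq (seq O)) (S : exset) (c : concept) : Prop :=
  exists2 p, learner B S = Some p & computes B p c.

Definition teacher (B : seq (seq O)) (c : concept) : option exset :=
  the_first (elt E) (fun S => identifies B S c).

Definition teaching_size (B : seq (seq O)) (c : concept) : option nat :=
  omap (delta E) (teacher B c).

Definition in_teaching_book (c : concept) (w : exset) (p : program O) : Prop :=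
  [/\ is_concept c, teacher [::] c = Some w, learner [::] w = Some p
    & computes [::] p c].

Definition interposed (c : concept) (B : seq (seq O)) : Prop :=
  is_library B /\ size_gt (teaching_size B c) (teaching_size [::] c).

(* Another set [S] with the same delta as [w] may also identify [c], through a
   program for [c] that precedes the learner's answer on [w] and is
   incompatible with [w] only because of the time bound.  If that program
   precedes @, it precedes every call, so it is still the answer on [S]
   whatever the library, and no library raises the teaching size of [c].
   Instantiated at S = w, the condition says that @ precedes the answer on
   [w]. *)
Definition ties_follow_call (c : concept) (w : exset) : Prop :=
  forall S q, delta E S = delta E w ->
    learner [::] S = Some q -> computes [::] q c -> prec [:: call O 0] q.

End Teaching.

(* Main.v *)
Require Import Defs.
From mathcomp Require Import all_boot all_order.
From mathcomp Require Import finmap.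
From mathcomp.classical Require Import boolp.

(** Only finitely many example sets S have delta S <= delta w.  For each of
    them, extend S by one wrong answer for c, of output length 0, on a fresh
    input: this does not increase the longest output, so a trie program for the
    extension still meets the time bound of S, and it does not compute c.  Let
    the library consist of these tries.  On such an S the learner answers at
    the latest with the call of the trie of S.  Its answer is then either a
    call, which does not compute c, or a program without calls that precedes @;
    the latter is also the answer without library, so if it computed c then
    delta S = delta w by minimality of w, contradicting the hypothesis on
    ties. *)

Set Implicit Arguments.
Unset Strict Implicit.
Unset Printing Implicit Defensive.

Local Open Scope fmap_scope.

Lemma the_firstP (T : Type) (lt : rel T) (P : T -> Prop) (x : T) :
  the_first lt P = Some x -> first_for lt P x.
Proof.
rewrite /the_first; case: pselect => // h [<-]; exact: projT2 (cid h).
Qed.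

(** Asymmetry makes a first element unique, so the one picked by choice must be [x]. *)
Lemma first_the_first (T : Type) (lt : rel T) (P : T -> Prop) (x : T) :
  (forall y z, lt y z -> ~~ lt z y) ->
  first_for lt P x -> the_first lt P = Some x.
Proof.
move=> asym [Px xmin]; rewrite /the_first.
case: pselect => [h|[]]; last by exists x.
case: (cid h) => y [Py ymin] /=; congr Some.
case: (xmin y Py) => // ltxy; case: (ymin x Px) => // ltyx.
by have := asym _ _ ltxy; rewrite ltyx.
Qed.

Section Order.
Context (d : Order.disp_t) (O : finOrderType d).

Lemma instr_lt_asym (a b : O + nat) : instr_lt a b -> ~~ instr_lt b a.
Proof.
case: a b => [x|i] [y|j] //=; first by move=> /Order.POrderTheory.lt_gtF->.
by move=> ltij; rewrite -leqNgt ltnW.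
Qed.

Lemma lex_lt_asym (p q : seq (O + nat)) : lex_lt p q -> ~~ lex_lt q p.
Proof.
elim: p q => [|a p IHp] [|b q] //= /orP[ltab|/andP[/eqP-> ltpq]].
  rewrite negb_or instr_lt_asym //=; case: eqP => //= eqba.
  by move: ltab (instr_lt_asym ltab); rewrite eqba => ->.
rewrite (negbTE (IHp _ ltpq)) andbF orbF.
by apply/negP=> ltbb; have := instr_lt_asym ltbb; rewrite ltbb.
Qed.

Lemma prec_asym (p q : seq (O + nat)) : prec p q -> ~~ prec q p.
Proof.
rewrite /prec => /orP[ltpq|/andP[/eqP-> /lex_lt_asym]].
  by rewrite negb_or -leqNgt (ltnW ltpq) gtn_eqF.
by rewrite ltnn eqxx.
Qed.

(** Length is compared first, so [q] has at most one instruction, and instructions of [O] precede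
    all calls. *)
Lemma prec_call (q : seq (O + nat)) (j : nat) :
  prec q [:: call O j] ->
  is_program [::] q /\ prec q [:: call O 0] \/ exists k, q = [:: call O k].
Proof. by case: q => [|[x|k] [|b q]] //=; [left|left|right; exists k]. Qed.

Lemma is_program_nil (B : seq (seq O)) (q : seq (O + nat)) :
  is_program [::] q -> is_program B q.
Proof. by apply: sub_all => -[]. Qed.

Lemma expand_nil (B : seq (seq O)) (q : seq (O + nat)) :
  is_program [::] q -> expand B q = expand [::] q.
Proof.
by rewrite /expand; elim: q => //= -[x|k] q IHq //= /IHq->.
Qed.

Lemma expand_call (B : seq (seq O)) (j : nat) :
  expand B [:: call O j] = nth [::] B j.
Proof. by rewrite /expand /= cats0. Qed.

End Order.

Lemma imax_len_ge (S : exset) (i : word) : i \in domf S -> size i <= imax_len S.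
Proof. by move=> iS; apply: (leq_bigmax [` iS]%fset). Qed.

Lemma omax_len_ge (S : exset) (i : word) (o : option word) :
  S.[? i] = Some o -> out_len o <= omax_len S.
Proof.
case: fndP => // iS [<-].
exact: (leq_bigmax (F := fun i : domf S => out_len (S i))).
Qed.

Lemma omax_len_set (S : exset) (i : word) (o : option word) :
  out_len o = 0 -> omax_len S.[i <- o] <= omax_len S.
Proof.
move=> o0; apply/bigmax_leqP => j _.
have: S.[i <- o].[? val j] = Some (S.[i <- o] j) by rewrite Some_fnd.
rewrite fnd_set; case: eqP => _; first by case=> <-; rewrite o0.
exact: omax_len_ge.
Qed.

(** A prefix-free [encode] is injective, and there are finitely many words of length at most [n] to
    decode. *)
Lemma finite_delta_le (E : example_coding) (n : nat) :
  exists s : seq exset, forall S, delta E S <= n -> S \in s.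
Proof.
have [s sP] : exists s : seq word, forall v : word, size v <= n -> v \in s.
  exists (flatten [seq [seq val t | t <- enum {: m.-tuple bool}]
                  | m <- iota 0 n.+1]).
  move=> v vn; apply/flatten_mapP; exists (size v); first by rewrite mem_iota.
  by apply/mapP; exists (in_tuple v); rewrite ?mem_enum.
pose dec v := if pselect (exists S, encode E S = v) is left h
              then Some (projT1 (cid h)) else None.
exists (pmap dec s) => S Sn; rewrite mem_pmap; apply/mapP.
exists (encode E S); first exact: sP.
rewrite /dec; case: pselect => [h|[]]; last by exists S.
case: (cid h) => T /= eqTS; congr Some.
by apply: (@encode_prefix_free E); rewrite eqTS prefix_refl.
Qed.

Lemma separating_trie (d : Order.disp_t) (O : finOrderType d) (L : language O)
    (f : nat -> nat) (c : concept) (S : exset) :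
  exists b : seq O,
    (forall B p, expand B p = b -> compatible L f B p S) /\
    (forall B p, expand B p = b -> ~ computes L B p c).
Proof.
(* Longer than every input of [S], hence fresh. *)
pose i0 := nseq (imax_len S).+1 true.
have i0S : i0 \notin domf S.
  by apply/negP => /imax_len_ge; rewrite size_nseq ltnn.
(* Differs from [c i0]; both possible values have [out_len] 0. *)
pose o0 : option word := if c i0 is Some _ then None else Some [::].
have [b bP] := trie_program L S.[i0 <- o0].
exists b; split=> B p eb; last first.
  case=> _ /(_ i0); rewrite /run eb.
  have /bP : S.[i0 <- o0].[? i0] = Some o0 by rewrite fnd_set eqxx.
  rewrite /o0; case: (c i0) => [y -> //|[t -> //]].
move=> i o iSo; rewrite /run eb.
have iS : i \in domf S by rewrite -fndSome iSo.
have /bP : S.[i0 <- o0].[? i] = Some o.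
  by rewrite fnd_set; case: eqP iS i0S => // -> ->.
case: o {iSo} => [y [t -> le_t]|-> //].
exists t => //; apply: (leq_trans le_t); rewrite /time_bound leq_max.
apply/orP; right; rewrite /trie_bound leq_add //.
  (* The fresh input raises the longest input length, but for [i] in [S] the minimum in the bound of
     [S] is already [size i]. *)
  rewrite leq_mul2l (minn_idPl (imax_len_ge iS)) geq_minl orbT //.
by apply: omax_len_set; rewrite /o0; case: (c i0).
Qed.

(** Programs without calls run alike under every library and are all candidates in L_B, so being
    first there implies being first in L. *)
Lemma learner_before_call (d : Order.disp_t) (O : finOrderType d)
    (L : language O) (f : nat -> nat) (B : seq (seq O)) (S : exset)
    (q : seq (O + nat)) :
  is_program [::] q -> learner L f B S = Some q -> learner L f [::] S = Some q.
Proof.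
move=> q0 learn_q; have [[_ qS] qmin] := the_firstP learn_q.
apply: first_the_first => [|].
  exact: prec_asym.
split=> [|r [r0 rS]].
  by split=> //; move: qS; rewrite /compatible /run (expand_nil B q0).
apply: qmin; split; first exact: is_program_nil.
by move: rS; rewrite /compatible /run (expand_nil B r0).
Qed.

Theorem proposition2 (d : Order.disp_t) (O : finOrderType d) (L : language O)
  (E : example_coding) (f : nat -> nat)
  (c : concept) (w : exset) (p : program O)
  (book : in_teaching_book L E f c w p)
  (call_first : prec [:: call O 0] p)
  (ties : ties_follow_call L E f c w) :
  exists B : seq (seq O), interposed L E f c B.
Proof.
have [_ teach_w _ _] := book; have [_ wmin] := the_firstP teach_w.
have [s sP] := finite_delta_le E (delta E w).
have [trie trieP] := choice (separating_trie L f c).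
(* Distinct example sets may share a trie, whereas primitives must be distinct. *)
pose B := undup (map trie s); exists B; split; first exact: undup_uniq.
(* Without a witness set under [B] the teaching size is infinite and the claim is immediate. *)
rewrite /teaching_size teach_w; case teach_S: teacher => [S|] //=.
rewrite ltnNge; apply/negP => le_Sw.
have [[q learn_q qc] _] := the_firstP teach_S.
have [_ qmin] := the_firstP learn_q.
(* The call may reach the trie of a set [T] other than [S], but no trie computes [c]. *)
have not_call k : q <> [:: call O k].
  move=> eq_q; have qc' := qc; rewrite eq_q in qc'.
  have [/andP[/(mem_nth [::])]] := qc'.
  rewrite mem_undup => /mapP[T _ eT] _ _.
  have [_ no] := trieP T; apply: (no B [:: call O k]) => //.
  by rewrite expand_call; exact: eT.
have trieB : trie S \in B by rewrite mem_undup map_f // sP.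
have : prec q [:: call O (index (trie S) B)].
  case: (qmin [:: call O (index (trie S) B)]) => [|/esym/not_call|] //.
  split; first by rewrite /= index_mem trieB.
  by have [ok _] := trieP S; apply: ok; rewrite expand_call nth_index.
case/prec_call => [[q0 ltq]|[k /not_call]] //.
have learn0 := learner_before_call q0 learn_q.
have qc0 : computes L [::] q c.
  by case: qc => _ qc; split=> // i; rewrite /run -(expand_nil B q0); apply: qc.
have le_wS : delta E w <= delta E S.
  by case: (wmin S) => [|->|/elt_size] //; exists q.
have eq_delta : delta E S = delta E w.
  by apply/eqP; rewrite eqn_leq le_Sw le_wS.
have := prec_asym (ties _ _ eq_delta learn0 qc0).
by rewrite ltq.
Qed.
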